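(* Let $G=(V,E)$ be a DAG. Then: (1) For $i\in V$ and $A\subseteq V\setminus\{i\}$: $\omega_{i|A}(\phi_G(\Omega,\Lambda))=\omega_i$ for all parameters $(\Omega,\Lambda)$ if and only if $\mathrm{pa}(i)\subseteq A\subseteq V\setminus\overline{\mathrm{de}}(i)$. (2) If $i\neq j$ and $ij\notin E$, then $\lambda_{ij|A}(\Sigma)=0$ for every $\Sigma\in\mathcal M(G)$ if and only if $A\setminus\{i\}$ d-separates $i$ and $j$ in $G$. (3) If $ij\in E$, then $\lambda_{ij|A}(\phi_G(\Omega,\Lambda))=\lambda_{ij}$ for all parameters $(\Omega,\Lambda)$ if and only if $i\in A\subseteq V\setminus\overline{\mathrm{de}}(j)$ and $A\setminus\{i\}$ d-separates $i$ and $j$ in the graph $G_{ij}$ obtained from $G$ by deleting the edge $ij$ and all vertices in $\mathrm{de}(j)$.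
   Context: $G=(V,E)$ is a DAG, edges $i\to j$ written $ij$; $\mathrm{pa}(j)$ parents, $\mathrm{de}(j)$ descendants of $j$ (excluding $j$), $\overline{\mathrm{de}}(j)=\{j\}\cup\mathrm{de}(j)$. Parameters: $\Omega=\mathrm{diag}(\omega_i)_{i\in V}$ with $\omega_i>0$, and $\Lambda=(\lambda_{ij})\in\mathbb R^{V\times V}$ with $\lambda_{ij}=0$ whenever $ij\notin E$. $\phi_G(\Omega,\Lambda)=(I-\Lambda)^{-T}\Omega(I-\Lambda)^{-1}$ and $\mathcal M(G)$ is the image of $\phi_G$ (a set of positive definite matrices). For $\Sigma$ symmetric, $\Sigma_A$ is the principal submatrix on $A$, and for $K\subseteq V\setminus\{i,j\}$, $\Sigma_{ij|K}$ is the submatrix with rows ordered $(i,K)$ and columns $(j,K)$ (same order of $K$); $|\cdot|$ is determinant. Define $\omega_{i|A}(\Sigma)=|\Sigma_{\{i\}\cup A}|/|\Sigma_A|$ and $\lambda_{ij|A}(\Sigma)=|\Sigma_{ij|A\setminus\{i\}}|/|\Sigma_A|$. d-separation: for disjoint $I,J,K$, $K$ d-separates $I$ and $J$ if every path between a vertex of $I$ and one of $J$ contains either a non-collider in $K$ or a collider that is not in $K$ and has no descendant in $K$. *)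

(* Defs.v *)
From HB Require Import structures.
From mathcomp Require Import all_boot all_order all_algebra.
From mathcomp Require Import reals.
Set Implicit Arguments. Unset Strict Implicit. Unset Printing Implicit Defensive.
Import Order.TTheory GRing.Theory Num.Theory.
Local Open Scope ring_scope.

Section Graphs.
Variable V : finType.

Definition dag (E : rel V) : Prop := forall x y, E x y -> ~~ connect E y x.

Definition pa (E : rel V) (j : V) : {set V} := [set i | E i j].
Definition de (E : rel V) (j : V) : {set V} := [set w | (w != j) && connect E j w].
Definition dbar (E : rel V) (j : V) : {set V} := j |: de E j.

Definition is_path (E : rel V) (x y : V) (p : seq V) : Prop :=
  [/\ p != [::], head x p = x, last x p = y,
      path (fun u v => E u v || E v u) x (behead p) & uniq p].

Definition collider (E : rel V) (u v w : V) : bool := E u v && E w v.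

Definition blocked (E : rel V) (K : {set V}) (x : V) (p : seq V) : Prop :=
  exists k : nat, [/\ (0 < k)%N, (k < (size p).-1)%N &
    let u := nth x p k.-1 in let v := nth x p k in let w := nth x p k.+1 in
    (~~ collider E u v w && (v \in K)) ||
    [&& collider E u v w, v \notin K & [disjoint de E v & K]]].

Definition dsep (E : rel V) (K I J : {set V}) : Prop :=
  forall x y p, x \in I -> y \in J -> is_path E x y p -> blocked E K x p.

(* G_{ij}: delete the edge ij and all vertices of de(j) (these become isolated) *)
Definition Gdel (E : rel V) (i j : V) : rel V :=
  fun x y => [&& E x y, (x, y) != (i, j), x \notin de E j & y \notin de E j].

End Graphs.

Section Model.
Variables (R : realType) (n : nat).

Definition param (E : rel 'I_n) (w : 'I_n -> R) (L : 'M[R]_n) : Prop :=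
  (forall i, 0 < w i) /\ (forall i j, ~~ E i j -> L i j = 0).

Definition Omega (w : 'I_n -> R) : 'M[R]_n := diag_mx (\row_i w i).

Definition phi (w : 'I_n -> R) (L : 'M[R]_n) : 'M[R]_n :=
  (invmx (1%:M - L))^T *m Omega w *m invmx (1%:M - L).

Definition inM (E : rel 'I_n) (S : 'M[R]_n) : Prop :=
  exists w L, param E w L /\ S = phi w L.

Definition sidx (A : {set 'I_n}) (a : 'I_#|A|) : 'I_n := @enum_val _ (pred_of_set A) a.

Definition subP (S : 'M[R]_n) (A : {set 'I_n}) : 'M[R]_#|A| :=
  \matrix_(a, b) S (sidx a) (sidx b).

Definition subX (S : 'M[R]_n) (i j : 'I_n) (K : {set 'I_n}) : 'M[R]_(#|K|.+1) :=
  \matrix_(a, b) S (if unlift ord0 a is Some k then sidx k else i)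
                   (if unlift ord0 b is Some k then sidx k else j).

Definition omega_cond (S : 'M[R]_n) (i : 'I_n) (A : {set 'I_n}) : R :=
  \det (subP S (i |: A)) / \det (subP S A).

Definition lambda_cond (S : 'M[R]_n) (i j : 'I_n) (A : {set 'I_n}) : R :=
  \det (subX S i j (A :\ i)) / \det (subP S A).

End Model.

(* Main.v *)
Require Import Defs.
From HB Require Import structures.
From mathcomp Require Import all_boot all_order all_algebra.
From mathcomp Require Import all_fingroup.
From mathcomp Require Import reals.
Set Implicit Arguments. Unset Strict Implicit. Unset Printing Implicit Defensive.
Import Order.TTheory GRing.Theory Num.Theory.
Local Open Scope ring_scope.

(* Write S = phi w L and M = (1 - L)^-1, so that S a b is the sum over c of
   M c a * w c * M c b, and M c a <> 0 only if there is a directed path from c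
   to a.

   d-separation forces |S_{ij|K}| = 0: restricted to the ancestors of i, j and
   K, the precision matrix (1 - L) Omega^-1 (1 - L)^T has a nonzero entry at
   (a, b) only if a and b are adjacent or have a common child, and the set U of
   the vertices outside K reached from i by active walks is closed under this
   relation.  An active walk is shortened to a path by cutting at repeated
   vertices.

   Conversely, erase the arrows leaving K, and join two vertices of {i, j} and K
   when they have a common ancestor.  An unblocked path from i to j yields a
   connection from i to j, hence an induced path i = x_0, ..., x_r = j.  Erase
   also the arrows into the other vertices of K, and give weight 1 to what
   remains: then S x_a x_b is nonzero exactly when |a - b| <= 1, and S_{ij|K} is
   triangular up to a permutation, and nonsingular.

   omega_{i|A} and lambda_{ij|A} are the residual variance and a coefficient of a
   linear regression on A, so that they can be read off any solution of the
   normal equations.  This gives the sufficiency of the conditions in (1) and (3),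
   and the necessity by parameters supported on a single arrow or on directed
   paths to the first vertex of A. *)

(** * Induction, directed paths and ancestors in acyclic graphs *)

Section DirectedGraphs.
Variable V : finType.
Implicit Types (E F : rel V) (K : {set V}).

Lemma dag_sub E F : subrel F E -> dag E -> dag F.
Proof.
move=> FE dE x y /FE/dE; apply: contra.
by apply: connect_sub => u v /FE; apply: connect1.
Qed.

Lemma dagF E u v : dag E -> E u v -> E v u = false.
Proof. by move=> dE /dE; apply: contraNF; apply: connect1. Qed.

(** Induction on the number of ancestors: if [E u v], those of [u] are among those of [v], and [v]
    is not one of them. *)
Lemma dag_ind E (P : V -> Prop) : dag E ->
  (forall v, (forall u, E u v -> P u) -> P v) -> forall v, P v.
Proof.
move=> dE IH v.
have [m] := ubnP #|[set u | connect E u v]|.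
elim: m v => // m IHm v; rewrite ltnS => lt_m; apply: IH => u Euv; apply: IHm.
apply: leq_trans lt_m; apply: proper_card; apply/properP; split.
  apply/subsetP => x; rewrite !inE => xu.
  exact: connect_trans xu (connect1 Euv).
by exists v; rewrite !inE ?connect0 // dE.
Qed.

Lemma connect_last E u v : connect E u v -> u != v ->
  exists2 x, connect E u x & E x v.
Proof.
case/connectP => p; case/lastP: p => [|p y] /=; first by move=> _ ->; rewrite eqxx.
rewrite rcons_path last_rcons => /andP[pp Ey] -> _.
by exists (last u p) => //; apply/connectP; exists p.
Qed.

Lemma connect_head E u v : connect E u v -> u != v ->
  exists2 x, E u x & connect E x v.
Proof.
case/connectP => -[|x p] /= ; first by move=> _ ->; rewrite eqxx.
by move=> /andP[Eux pp] -> _; exists x => //; apply/connectP; exists p.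
Qed.

(** Contains [K], as [connect] is reflexive; lying outside it is the blocking condition on
    colliders. *)
Definition sub_anc E K : {set V} := [set v | [exists k in K, connect E v k]].

Lemma sub_ancP E K v :
  reflect (exists2 k, k \in K & connect E v k) (v \in sub_anc E K).
Proof.
rewrite inE; apply: (iffP existsP) => [[k /andP[kK vk]]|[k kK vk]].
  by exists k.
by exists k; rewrite kK.
Qed.

Lemma sub_sub_anc E K v : v \in K -> v \in sub_anc E K.
Proof. by move=> vK; apply/sub_ancP; exists v. Qed.

Lemma sub_anc_connect E K u v :
  connect E u v -> v \in sub_anc E K -> u \in sub_anc E K.
Proof.
move=> uv /sub_ancP[k kK vk]; apply/sub_ancP.
by exists k => //; apply: connect_trans vk.
Qed.

Lemma sub_ancE E K v :
  (v \in sub_anc E K) = (v \in K) || ~~ [disjoint de E v & K].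
Proof.
apply/sub_ancP/orP => [[k kK vk]|[vK|/pred0Pn[k]]].
- have [->|kv] := eqVneq v k; [by left | right].
  by apply/pred0Pn; exists k => /=; rewrite inE vk eq_sym kv.
- by exists v.
- by rewrite /= inE => /andP[/andP[_ vk] kK]; exists k.
Qed.

(** * Active walks *)

Definition adj E u v := E u v || E v u.

Definition active E K u v w :=
  if collider E u v w then v \in sub_anc E K else v \notin K.

(** A walk is a function, so that cutting it is a reindexing; only the values up to [m] matter. *)
Definition active_walk E K (f : nat -> V) m :=
  (forall k, (k < m)%N -> adj E (f k) (f k.+1)) /\
  (forall k, (k.+1 < m)%N -> active E K (f k) (f k.+1) (f k.+2)).

(* The cut creates a single new triple.  If it is a collider u -> v <- w, the
   removed closed walk starts either with an arrow into v, or with an arrow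
   out of v; in the latter case following the arrows downwards meets a collider,
   which is an ancestor of K, since the graph has no directed cycle. *)
Lemma active_walk_cut E K f m a b : dag E -> active_walk E K f m ->
  (a < b <= m)%N -> f a = f b ->
  active_walk E K (fun k => if (k <= a)%N then f k else f (k + (b - a))%N)
    (m - (b - a)).
Proof.
move=> dE [fadj fact] /andP[ab bm] fab.
set g := fun k => _.
have gge k : (a <= k)%N -> g k = f (k + (b - a))%N.
  rewrite /g leq_eqVlt => /orP[/eqP<-|]; last by rewrite ltnNge => /negbTE->.
  by rewrite leqnn addnC subnK // ltnW.
have gle k : (k <= a)%N -> g k = f k by rewrite /g => ->.
split=> k km.
  have [ka|ak] := ltnP k a.
    by rewrite !gle ?(ltnW ka) //; apply: fadj; apply: leq_trans ka _;
       apply: leq_trans bm; apply: ltnW.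
  by rewrite !gge ?leqW // addSn; apply: fadj; rewrite addnC -ltn_subRL.
have lt_bm : (k.+1 + (b - a) < m)%N by rewrite addnC -ltn_subRL.
have [k2a|] := leqP k.+2 a.
  rewrite !gle ?(ltnW k2a) ?(ltnW (ltnW k2a)) //; apply: fact.
  by apply: leq_trans k2a _; apply: leq_trans bm; apply: ltnW.
rewrite ltnS leq_eqVlt => /orP[/eqP/esym ka|ak]; last first.
  have {}ak : (a <= k)%N by [].
  rewrite !gge ?leqW //.
  by rewrite !addSn; apply: fact; rewrite -addSn.
have -> : g k = f k by apply: gle; rewrite -ka.
have -> : g k.+1 = f a by rewrite ka gle.
have -> : g k.+2 = f (k.+2 + (b - a))%N by apply: gge; rewrite -ka.
have ekb : (k.+2 + (b - a) = b.+1)%N by rewrite ka addSn addnC subnK // ltnW.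
rewrite {}ekb; have {}lt_bm : (b < m)%N.
  by rewrite ka addnC subnK ?(ltnW ab) // in lt_bm.
(* The new triple has the first edge of [t1], the last edge of [t2] and their common middle vertex.
   If it is not a collider, neither is one of these two. *)
have t1 : active E K (f k) (f a) (f a.+1).
  by rewrite -ka; apply: fact; rewrite ka (leq_trans ab).
have t2 : active E K (f b.-1) (f b) (f b.+1).
  by have := fact b.-1; rewrite (ltn_predK ab); apply.
rewrite /active /collider; case: ifP => [/andP[Eka Eba]|]; last first.
  move/negbT; rewrite negb_and => /orP[/negbTE n|/negbTE n].
    by move: t1; rewrite /active /collider n.
  by move: t2; rewrite /active /collider -fab n andbF.
move: t1; rewrite /active /collider Eka /=; case: ifP => // nE _.
have Ea : E (f a) (f a.+1).
  by have := fadj a (leq_trans ab bm); rewrite /adj nE orbF.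
have chain t : (a + t < b)%N -> f a \in sub_anc E K \/
    (E (f (a + t)%N) (f (a + t).+1) /\ connect E (f a.+1) (f (a + t).+1)).
  elim: t => [|t IHt] atb; first by right; rewrite addn0.
  have atb' : (a + t < b)%N by apply: leq_trans atb; rewrite addnS.
  have [?|[Et ct]] := IHt atb'; first by left.
  rewrite addnS in atb *.
  have := fact _ (leq_trans atb bm); rewrite /active /collider Et /=.
  case: ifP => [_ an|nEt _].
    left; apply: sub_anc_connect an.
    exact: connect_trans (connect1 Ea) ct.
  have Et' : E (f (a + t).+1) (f (a + t).+2).
    by have := fadj _ (leq_trans atb bm); rewrite /adj nEt orbF.
  by right; split=> //; apply: connect_trans ct (connect1 Et').
have lt1 : (a + (b.-1 - a) < b)%N.
  by rewrite subnKC; [rewrite (ltn_predK ab) | rewrite -ltnS (ltn_predK ab)].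
(* At the end of the loop, the second alternative is a directed path from [f a.+1] back to
   [f b = f a]. *)
have [//|[_]] := chain _ lt1.
rewrite subnKC; last by rewrite -ltnS (ltn_predK ab).
by rewrite (ltn_predK ab) -fab (negbTE (dE _ _ Ea)).
Qed.

Lemma active_walk_path E K f m i j : dag E -> active_walk E K f m ->
  f 0%N = i -> f m = j -> exists2 p, is_path E i j p & ~ blocked E K i p.
Proof.
move=> dE; have [N] := ubnP m; elim: N m f => // N IHN m f.
rewrite ltnS => mN fw f0 fm.
have [/injectiveP inj|] := boolP (injectiveb (fun k : 'I_m.+1 => f k)).
  exists (mkseq f m.+1).
    have e0 : mkseq f m.+1 = f 0%N :: [seq f k | k <- iota 1 m] by [].
    split=> //.
    - by rewrite (last_nth i) size_mkseq /= (nth_map 0%N) ?size_iota // nth_iota.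
    - rewrite e0 /=; apply/(pathP i) => k; rewrite size_map size_iota => km.
      rewrite -f0 -e0 nth_mkseq ?(leqW km) // (nth_map 0%N) ?size_iota //.
      by rewrite nth_iota // add1n; apply: fw.1.
    - rewrite map_inj_in_uniq ?iota_uniq // => x y.
      rewrite !mem_iota !add0n /= => xm ym fxy.
      by have /(congr1 val) := inj (Ordinal xm) (Ordinal ym) fxy.
  case=> k []; rewrite size_mkseq => k0 km; cbv zeta.
  have {}km : (k < m)%N by [].
  have km1 : (k.-1 < m.+1)%N by rewrite ltnS (leq_trans (leq_pred k)) // ltnW.
  rewrite (nth_mkseq _ _ km1) (nth_mkseq _ _ (leqW km)).
  rewrite (@nth_mkseq _ _ _ m.+1) //.
  have := fw.2 k.-1; rewrite prednK // => /(_ km); rewrite /active.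
  case: ifP => _ /=; last by move=> /negbTE->.
  by rewrite sub_ancE => /orP[->|/negbTE->]; rewrite ?andbF.
move=> /injectivePn[x [y nxy]].
wlog xy : x y nxy / (x < y)%N => [wl|] fxy.
  have [xy|yx|/val_inj exy] := ltngtP x y; first exact: (wl x y).
    by apply: (wl y x) => //; rewrite eq_sym.
  by rewrite exy eqxx in nxy.
have ym : (y <= m)%N by rewrite -ltnS.
have xym : (x < y <= m)%N by rewrite xy.
have le_d : (y - x <= m)%N by apply: leq_trans (leq_subr _ _) ym.
have le_x : (x <= m - (y - x))%N by rewrite leq_subRL // addnC subnKC // ltnW.
apply: IHN (active_walk_cut dE fw xym fxy) _ _ => //=.
  apply: leq_trans mN; rewrite ltn_subrL subn_gt0 xy.
  by rewrite (leq_trans _ ym) ?(leq_ltn_trans _ xy).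
(* [h] means that the cut reaches the end of the walk, [y = m]; the new last vertex is then
   [f x = f y]. *)
case: ifP => h; last by rewrite subnK.
have ex : (m - (y - x) = x)%N by apply/eqP; rewrite eqn_leq h.
rewrite ex fxy -fm; congr f.
by have := subnK le_d; rewrite ex subnKC // ltnW.
Qed.

(** Activity concerns two consecutive edges, so active walks become [connect] on edges, which is
    decidable. *)
Definition walk_step E K (e e' : V * V) :=
  [&& e.2 == e'.1, adj E e'.1 e'.2 & active E K e.1 e.2 e'.2].

(* Some active walk starts in i and ends with the edge e. *)
Definition active_edge E K i e :=
  [exists a, adj E i a && connect (walk_step E K) (i, a) e].

Lemma active_edgeP E K i u v : dag E -> active_edge E K i (u, v) ->
  exists2 p, is_path E i v p & ~ blocked E K i p.
Proof.
move=> dE /existsP[a /andP[ia /connectP[s sp se]]].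
pose e k := nth (i, a) ((i, a) :: s) k.
pose f k := if k is k'.+1 then (e k').2 else i.
have stepe k : (k < size s)%N -> walk_step E K (e k) (e k.+1).
  by move=> ks; have /pathP/(_ _ ks) := sp; apply.
have fe k : (k <= size s)%N -> e k = (f k, f k.+1).
  case: k => [|k] ks //; case/and3P: (stepe k ks) => /eqP /= -> _ _.
  by rewrite -surjective_pairing.
apply: (@active_walk_path E K f (size s).+1) => //; last first.
  by rewrite /= /e -last_nth -se.
split=> k ks.
  case: k ks => [|k] ks //; case/and3P: (stepe k ks).
  by rewrite (fe k.+1).
by case/and3P: (stepe k ks) => _ _; rewrite !fe //= ltnW.
Qed.

Lemma active_edge_start E K i a : adj E i a -> active_edge E K i (i, a).
Proof. by move=> ia; apply/existsP; exists a; rewrite ia connect0. Qed.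

Lemma active_edge_step E K i u v w : active_edge E K i (u, v) ->
  adj E v w -> active E K u v w -> active_edge E K i (v, w).
Proof.
move=> /existsP[a /andP[ia c]] vw act; apply/existsP; exists a; rewrite ia /=.
by apply: connect_trans c (connect1 _); rewrite /walk_step /= eqxx vw.
Qed.

(** The walk climbs from [i] to [v] against the arrows, without colliders, and then moves to [w]. It
    avoids [K] because [v] is not an ancestor of [K]. *)
Lemma active_edge_up E K i v w : dag E -> connect E v i ->
  v \notin sub_anc E K -> adj E v w -> active_edge E K i (v, w).
Proof.
move=> dE /connectP[p]; elim: p v w => [|v1 p IHp] v w /=.
  by move=> _ -> _; apply: active_edge_start.
move=> /andP[Ev pp] ei vK vw.
have v1K : v1 \notin sub_anc E K.
  by apply: contra vK; apply: sub_anc_connect; apply: connect1.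
apply: active_edge_step (IHp _ v pp ei v1K _) vw _.
  by rewrite /adj Ev orbT.
rewrite /active /collider (dagF dE Ev) /=; apply: contra vK.
exact: sub_sub_anc.
Qed.

Lemma active_edge_down E K i j u v : dag E -> connect E v j ->
  v \notin sub_anc E K -> active_edge E K i (u, v) ->
  exists u', active_edge E K i (u', j).
Proof.
move=> dE /connectP[p]; elim: p u v => [|v1 p IHp] u v /=.
  by move=> _ -> _; exists u.
move=> /andP[Ev pp] ej vK uv.
have v1K : v1 \notin sub_anc E K.
  by apply: contra vK; apply: sub_anc_connect; apply: connect1.
apply: IHp pp ej v1K _; apply: active_edge_step uv _ _; first by rewrite /adj Ev.
rewrite /active /collider (dagF dE Ev) andbF; apply: contra vK.
exact: sub_sub_anc.
Qed.

(* A collider outside the ancestors of K is bypassed by descending to i or j. *)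
Lemma active_edge_anc E K i j u v w : dag E ->
  (forall u', ~~ active_edge E K i (u', j)) ->
  active_edge E K i (u, v) -> adj E v w ->
  v \in sub_anc E (i |: (j |: K)) -> (~~ collider E u v w -> v \notin K) ->
  active_edge E K i (v, w).
Proof.
move=> dE nj uv vw van nK.
have [act|] := boolP (active E K u v w); first exact: active_edge_step uv vw act.
rewrite /active; case: ifP => [cl vK|/negbT/nK->] //.
case/sub_ancP: van => k; rewrite !inE => /or3P[/eqP->|/eqP->|kK] vk.
- exact: active_edge_up.
- by have [u' h] := active_edge_down dE vk vK uv; rewrite (negbTE (nj u')) in h.
- by case/sub_ancP: vK; exists k.
Qed.

(* U plays the role of the connected component of i, outside K, in the moral
   graph of the ancestors of i, j and K. *)
Lemma dsep_moral E K i j : dag E -> i != j -> i \notin K -> j \notin K ->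
  dsep E K [set i] [set j] ->
  let An := sub_anc E (i |: (j |: K)) in
  exists U : {set V}, [/\ i \in U, j \notin U, [disjoint U & K] &
    forall u v, u \in U -> v \notin K -> u \in An -> v \in An ->
      (adj E u v \/ exists2 c, c \in An & E u c && E v c) -> v \in U].
Proof.
move=> dE ij iK jK sep An.
have nj u' : ~~ active_edge E K i (u', j).
  apply/negP => /(active_edgeP dE)[p ip]; apply.
  by apply: sep ip; rewrite inE.
exists [set v | (v \notin K) && ((v == i) || [exists u, active_edge E K i (u, v)])].
split.
- by rewrite inE iK eqxx.
- rewrite inE jK eq_sym (negbTE ij) /=; apply/existsP => -[u].
  exact/negP.
- by rewrite disjoint_subset; apply/subsetP => v; rewrite !inE => /andP[].
move=> u v uU vK uan van uv; rewrite in_set vK /=.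
move: uU; rewrite in_set => /andP[uK ru].
have ext c : adj E u c -> active_edge E K i (u, c).
  move=> uc; case/orP: ru => [/eqP ei|/existsP[x xu]].
    by rewrite ei in uc *; apply: active_edge_start.
  exact: (active_edge_anc dE nj xu uc uan).
apply/orP; right; case: uv => [/ext uv|[c can /andP[Euc Evc]]].
  by apply/existsP; exists u.
(* The walk crosses [u -> c <- v]; [active_edge_anc] allows the collider because [c] lies in
   [An]. *)
apply/existsP; exists c.
apply: (active_edge_anc dE nj (ext c _)) => //; rewrite /adj ?Euc ?Evc ?orbT //.
by rewrite /collider Euc Evc.
Qed.

(** * Chains of common ancestors *)

Definition noexit E K : rel V := fun u v => E u v && (u \notin K).

Lemma connect_noexit_first E K v k : connect E v k -> k \in K ->
  exists2 k', k' \in K & connect (noexit E K) v k'.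
Proof.
case/connectP => p; elim: p v => [|v1 p IHp] v /=.
  by move=> _ -> kK; exists v.
have [vK _ _ _|vK /andP[Ev pp] ek kK] := boolP (v \in K); first by exists v.
have [k' k'K c] := IHp _ pp ek kK; exists k' => //.
by apply: connect_trans c; apply: connect1; rewrite /noexit Ev.
Qed.

(** Vertices of [K] outside [P] become isolated; those of [K] in [P] only receive arrows. *)
Definition only_entry E K (P : pred V) : rel V :=
  fun u v => noexit E K u v && ((v \notin K) || P v).

Lemma only_entry_sub E K P : subrel (only_entry E K P) E.
Proof. by move=> u v /andP[/andP[]]. Qed.

Lemma connect_only_entry E K (P : pred V) u v : (v \notin K) || P v ->
  connect (noexit E K) u v -> connect (only_entry E K P) u v.
Proof.
move=> vP /connectP[p]; elim: p u => [|u1 p IHp] u /=.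
  by move=> _ ->; apply: connect0.
move=> /andP[Eu pp] ev; apply: connect_trans (IHp _ pp ev).
apply: connect1; rewrite /only_entry Eu /=.
case: p pp ev {IHp} => [_ /= <- //|u2 p] /= /andP[/andP[_ ->]] //.
Qed.

Lemma only_entry_into E K (P : pred V) u k : k \in K -> ~~ P k ->
  only_entry E K P u k = false.
Proof. by move=> kK /negbTE kP; rewrite /only_entry kK kP andbF. Qed.

Lemma only_entry_from E K (P : pred V) k v : k \in K ->
  only_entry E K P k v = false.
Proof. by move=> kK; rewrite /only_entry /noexit kK andbF. Qed.

Definition common_anc F a b := [exists c, connect F c a && connect F c b].

Lemma common_ancC F a b : common_anc F a b = common_anc F b a.
Proof. by apply: eq_existsb => c; rewrite andbC. Qed.

Lemma common_anc_refl F a : common_anc F a a.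
Proof. by apply/existsP; exists a; rewrite connect0. Qed.

Lemma common_anc_connect F a b : connect F a b -> common_anc F a b.
Proof. by move=> ab; apply/existsP; exists a; rewrite connect0. Qed.

Lemma common_anc_isolated F a b : (forall u, F u a = false) ->
  (forall v, F a v = false) -> common_anc F a b -> a = b.
Proof.
move=> Fin Fout /existsP[c /andP[ca cb]].
have eca : c = a.
  by apply/eqP; apply: contraT => /(connect_last ca)[x _]; rewrite Fin.
rewrite eca in cb; apply/eqP; apply: contraT => /(connect_head cb)[x].
by rewrite Fout.
Qed.

Definition trek_rel E K i j : rel V := fun a b =>
  [&& a \in i |: (j |: K), b \in i |: (j |: K) & common_anc (noexit E K) a b].

Lemma trek_rel_sym E K i j : symmetric (trek_rel E K i j).
Proof. by move=> a b; rewrite /trek_rel andbCA common_ancC. Qed.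

(** An invariant is carried along the walk. After an arrow into [v], some vertex linked to [i]
    shares an ancestor with [v] ([A]); after an arrow out of [v], such a vertex lies below [v]
    ([B]). At a collider the linked vertex is replaced by a first vertex of [K] below the
    collider. *)
Lemma active_walk_trek E K f m i j : dag E -> active_walk E K f m ->
  i \notin K -> j \notin K -> (0 < m)%N ->
  f 0%N = i -> f m = j -> connect (trek_rel E K i j) i j.
Proof.
move=> dE [fadj fact] iK jK m0 f0 fm.
pose X := i |: (j |: K).
have iX : i \in X by rewrite !inE eqxx.
have jX : j \in X by rewrite !inE eqxx orbT.
have KX k : k \in K -> k \in X by move=> kK; rewrite !inE kK !orbT.
pose nE := noexit E K.
pose reach x := (x \in X) && connect (trek_rel E K i j) i x.
pose A v := exists2 x, reach x & common_anc nE x v.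
pose B v := v \notin K -> exists2 x, reach x & connect nE v x.
have nE1 u v : u \notin K -> E u v -> connect nE u v.
  by move=> uK Euv; apply: connect1; rewrite /nE /noexit Euv.
have stepA u v : u \notin K -> E u v -> A u -> A v.
  move=> uK Euv [x rx /existsP[c /andP[cx cu]]]; exists x => //.
  apply/existsP; exists c; rewrite cx /=.
  exact: connect_trans cu (nE1 _ _ uK Euv).
have ri : reach i by rewrite /reach iX connect0.
have inv k : (k < m)%N ->
    (E (f k) (f k.+1) -> A (f k.+1)) /\ (E (f k.+1) (f k) -> B (f k.+1)).
  elim: k => [|k IHk] km.
    split; rewrite f0 => Ef.
      by exists i => //; apply: common_anc_connect; apply: nE1.
    by move=> f1K; exists i => //; apply: nE1.
  have {IHk}[IA IB] := IHk (ltnW km).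
  have := fact _ km; rewrite /active /collider.
  have fk := fadj _ (ltnW km); have fk1 := fadj _ km.
  case: ifP => [/andP[E1 E2] an|/negbT ncol fK].
    split=> [/(dagF dE)|_ wK]; first by rewrite E2.
    have [x /andP[xX cx] xv] := IA E1.
    case/sub_ancP: an => k0 k0K /connect_noexit_first/(_ k0K)[k1 k1K vk1].
    exists k1; last exact: connect_trans (nE1 _ _ wK E2) vk1.
    rewrite /reach KX //=; apply: connect_trans cx (connect1 _).
    rewrite /trek_rel xX KX //=.
    case/existsP: xv => c /andP[c1 c2]; apply/existsP; exists c; rewrite c1 /=.
    exact: connect_trans c2 vk1.
  split=> Ew.
    case/orP: fk => Ev; first exact: stepA (IA Ev).
    have [x rx c] := IB Ev fK; apply: stepA Ew _ => //; exists x => //.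
    by rewrite common_ancC; apply: common_anc_connect.
  move=> wK; case/orP: fk => Ev; first by rewrite Ev Ew in ncol.
  have [x rx c] := IB Ev fK; exists x => //.
  exact: connect_trans (nE1 _ _ wK Ew) c.
have mm : (m.-1 < m)%N by rewrite ltn_predL.
have [IA IB] := inv _ mm; have mj := fadj _ mm.
have : A j.
  rewrite prednK // in IA IB mj.
  case/orP: mj => Ej; first by rewrite -fm; apply: IA.
  rewrite fm in IB Ej; have [x rx c] := IB Ej jK; exists x => //.
  by rewrite common_ancC; apply: common_anc_connect.
case=> x /andP[xX ix] xj; apply: connect_trans ix (connect1 _).
by rewrite /trek_rel xX jX.
Qed.

Lemma unblocked_trek E K i j p : dag E -> i != j -> i \notin K -> j \notin K ->
  is_path E i j p -> ~ blocked E K i p -> connect (trek_rel E K i j) i j.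
Proof.
move=> dE ij iK jK [p0 hp lp pp up] nb.
case: p p0 hp lp pp up nb => // x p _ /= -> {x} lp pp up nb.
have p0 : (0 < size p)%N.
  by case: p lp ij {pp up nb} => //= ->; rewrite eqxx.
apply: (@active_walk_trek E K (nth i (i :: p)) (size p)) => //; last first.
  by rewrite -last_nth.
split=> k km; first by have /pathP/(_ _ km) := pp; apply.
rewrite /active; apply/negPn/negP => bad; apply: nb.
exists k.+1; split=> //=; move: bad => /=.
case: ifP => /= _; last by move=> /negPn->.
by rewrite sub_ancE negb_or negbK => /andP[-> ->].
Qed.

End DirectedGraphs.

(** * Shortening a path to an induced one *)

Section InducedPaths.
Variables (T : eqType) (H : rel T).

Fixpoint induced (x : T) (p : seq T) : bool :=
  if p is y :: p' then all (fun z => ~~ H x z) p' && induced y p' else true.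

(** From [x], jump to the last vertex of [p] adjacent to [x] and recurse on what follows; stop as
    soon as the end point is met. *)
Lemma induced_path x p : path H x p ->
  exists p', [/\ path H x p', last x p' = last x p, induced x p',
    last x p' \notin belast x p' & {subset p' <= p}].
Proof.
have [N] := ubnP (size p); elim: N x p => // N IHN x p.
rewrite ltnS => pN pp.
have [el|nl] := eqVneq x (last x p); first by exists [::].
have [z [p1 [p2 [ep Hz np2]]]] : exists z p1 p2,
    [/\ p = p1 ++ z :: p2, H x z & all (fun y => ~~ H x y) p2].
  have: has (H x) p.
    by case: p pp nl {pN} => [|y p] /=; [rewrite eqxx | case/andP=> ->].
  elim: (p) => //= y q IHq; have [hq _|nq] := boolP (has (H x) q).
    have [z [p1 [p2 [-> Hz h]]]] := IHq hq.
    by exists z, (y :: p1), p2.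
  rewrite orbF => Hy; exists y, [::], q; split=> //.
  by rewrite -all_predC in nq.
move: pp; rewrite ep cat_path /= => /and3P[_ _ pp2].
have sz : (size p2 < N)%N.
  by apply: leq_trans pN; rewrite ep size_cat /= addnS ltnS leq_addl.
have [q [pq lq iq nq sq]] := IHN _ _ sz pp2.
have el : last x p = last z p2 by rewrite ep last_cat.
exists (z :: q); split=> /=.
- by rewrite Hz.
- by rewrite lq ?last_cat.
- rewrite iq andbT; apply/allP => y /sq yp2; exact: (allP np2).
- by rewrite inE negb_or nq andbT lq -el eq_sym.
- move=> y; rewrite inE mem_cat !inE => /orP[->|/sq->]; by rewrite ?orbT.
Qed.

End InducedPaths.

(** * Minors *)

Lemma inj_extend (T : finType) (U : eqType) (W : Type) (f : T -> U) (u : T -> W)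
  (w0 : W) : injective f -> exists v : U -> W, forall a, v (f a) = u a.
Proof.
move=> finj; exists (fun x => if [pick a | f a == x] is Some a then u a else w0).
by move=> a; case: pickP => [b /eqP/finj->|/(_ a)] //; rewrite eqxx.
Qed.

Section Minors.
Variables (R : realType) (n : nat).
Implicit Types (S : 'M[R]_n) (A K : {set 'I_n}) (i j : 'I_n).

Definition bidx i K (a : 'I_#|K|.+1) : 'I_n :=
  if unlift ord0 a is Some k then sidx k else i.

Lemma sidx_inj A : injective (@sidx n A).
Proof. exact: enum_val_inj. Qed.

Lemma sidxP A (a : 'I_#|A|) : sidx a \in A.
Proof. exact: enum_valP. Qed.

Lemma mem_sidx A x : x \in A -> exists a, x = @sidx n A a.
Proof.
by move=> xA; exists (enum_rank_in xA x); rewrite /sidx enum_rankK_in.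
Qed.

Lemma bidx_inj i K : i \notin K -> injective (@bidx i K).
Proof.
move=> iK a b; rewrite /bidx.
case: unliftP => [a'|] ->; case: unliftP => [b'|] -> //.
- by move=> /sidx_inj->.
- by move=> e; rewrite -e sidxP in iK.
- by move=> e; rewrite e sidxP in iK.
Qed.

Lemma bidx0 i K : @bidx i K ord0 = i.
Proof. by rewrite /bidx unlift_none. Qed.

Lemma bidxS i K k : @bidx i K (lift ord0 k) = sidx k.
Proof. by rewrite /bidx liftK. Qed.

Lemma bidxP i K a : @bidx i K a \in i |: K.
Proof.
rewrite /bidx; case: unliftP => [k|] _; rewrite in_setU1 ?eqxx //.
by rewrite sidxP orbT.
Qed.

Lemma mem_bidx i K x : x \in i |: K -> exists a, x = @bidx i K a.
Proof.
case/setU1P => [->|/mem_sidx[k ->]]; first by exists ord0; rewrite bidx0.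
by exists (lift ord0 k); rewrite bidxS.
Qed.

Lemma sum_sidx A (F : 'I_n -> R) :
  \sum_(a < #|A|) F (sidx a) = \sum_(a in A) F a.
Proof. exact: esym (big_enum_val F). Qed.

Lemma sum_bidx i K (F : 'I_n -> R) :
  \sum_(a < #|K|.+1) F (@bidx i K a) = F i + \sum_(a in K) F a.
Proof.
rewrite big_ord_recl bidx0 -sum_sidx; congr (_ + _).
by apply: eq_bigr => k _; rewrite bidxS.
Qed.

Lemma sum_supp i K (F : 'I_n -> R) : i \notin K ->
  (forall a, a \notin i |: K -> F a = 0) ->
  \sum_a F a = F i + \sum_(a in K) F a.
Proof.
move=> iK F0; rewrite (bigD1 i) //= [in RHS]big_mkcond /=; congr (_ + _).
rewrite [LHS]big_mkcond /=; apply: eq_bigr => a _.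
have [->|ai] := eqVneq a i; first by rewrite (negbTE iK).
by case: ifP => //= aK; rewrite F0 // in_setU1 (negbTE ai) aK.
Qed.

(** * Kernels of minors, Schur complements and Cramer's rule *)

Lemma det_subP_neq0 S A :
  (forall v : 'I_n -> R, (forall b, b \in A -> \sum_(a in A) v a * S a b = 0) ->
     forall a, a \in A -> v a = 0) ->
  \det (subP S A) != 0.
Proof.
move=> H; apply/det0P => -[u un0 /rowP uS].
have [v vE] := inj_extend (u 0) 0 (@sidx_inj A).
case/eqP: un0; apply/rowP => a; rewrite mxE -vE; apply: H (sidxP a).
move=> _ /mem_sidx[b ->]; have := uS b; rewrite !mxE => e; rewrite -[RHS]e.
by rewrite -sum_sidx; apply: eq_bigr => c _; rewrite mxE vE.
Qed.

Lemma det_subX_neq0 S i j K : i \notin K ->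
  (forall v : 'I_n -> R, (forall b, b \in j |: K ->
       v i * S i b + \sum_(a in K) v a * S a b = 0) ->
     forall a, a \in i |: K -> v a = 0) ->
  \det (subX S i j K) != 0.
Proof.
move=> iK H; apply/det0P => -[u un0 /rowP uS].
have [v vE] := inj_extend (u 0) 0 (bidx_inj iK).
case/eqP: un0; apply/rowP => a; rewrite mxE -vE; apply: H (bidxP _ a).
move=> _ /mem_bidx[b ->]; have := uS b; rewrite !mxE => e; rewrite -[RHS]e.
rewrite -(sum_bidx i K (fun a => v a * S a (bidx j b))).
by apply: eq_bigr => c _; rewrite mxE vE.
Qed.

Lemma det_subX_eq0 S i j K (v : 'I_n -> R) : v i != 0 ->
  (forall b, b \in j |: K -> v i * S i b + \sum_(a in K) v a * S a b = 0) ->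
  \det (subX S i j K) = 0.
Proof.
move=> vi H; apply/eqP/det0P; exists (\row_a v (@bidx i K a)).
  by apply: contra vi => /eqP/rowP/(_ ord0); rewrite !mxE bidx0 => ->.
apply/rowP => b; rewrite !mxE -[RHS](H _ (bidxP j b)).
rewrite -(sum_bidx i K (fun a => v a * S a (bidx j b))).
by apply: eq_bigr => c _; rewrite !mxE.
Qed.

Lemma subP_solve S A (g : 'I_n -> R) : \det (subP S A) != 0 ->
  exists v : 'I_n -> R, forall a, a \in A -> g a = \sum_(b in A) S a b * v b.
Proof.
rewrite -unitfE -unitmxE => uS.
pose c := invmx (subP S A) *m (\col_a g (sidx a)).
have [v vE] := inj_extend (fun b => c b 0) 0 (@sidx_inj A).
exists v => _ /mem_sidx[a ->].
have /colP/(_ a) := mulKVmx uS (\col_a g (sidx a)); rewrite !mxE => <-.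
by rewrite -sum_sidx; apply: eq_bigr => b _; rewrite mxE vE.
Qed.

(** The enumerations differ by a permutation acting on both rows and columns, so its sign is
    squared. *)
Lemma det_reindex S m1 m2 (f : 'I_m1 -> 'I_n) (g : 'I_m2 -> 'I_n) :
  injective f -> injective g -> codom f =i codom g ->
  \det (\matrix_(a, b) S (f a) (f b)) = \det (\matrix_(a, b) S (g a) (g b)).
Proof.
move=> finj ginj fg.
have em : m1 = m2.
  by have := eq_card fg; rewrite !card_codom // !card_ord.
subst m2.
have mem a : g a \in codom f by rewrite fg codom_f.
have sinj : injective (fun a => iinv (mem a)).
  by move=> a b /(congr1 f); rewrite !f_iinv => /ginj.
pose s := perm sinj.
have -> : \matrix_(a, b) S (g a) (g b) =
    row_perm s (col_perm s (\matrix_(a, b) S (f a) (f b))).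
  by apply/matrixP => a b; rewrite !mxE !permE !f_iinv.
rewrite row_permE col_permE !det_mulmx !det_perm odd_permV mulrCA.
by rewrite -signr_addb addbb mulr1.
Qed.

Lemma det_subX_diag S i K : i \notin K ->
  \det (subX S i i K) = \det (subP S (i |: K)).
Proof.
move=> iK; apply: det_reindex; [exact: bidx_inj | exact: sidx_inj |].
move=> x; apply/codomP/codomP => -[a ->].
  exact/mem_sidx/bidxP.
exact/mem_bidx/sidxP.
Qed.

Lemma det_subX_block S i j K : \det (subX S i j K) =
  \det (block_mx (S i j)%:M (\row_b S i (sidx b)) (\col_a S (sidx a) j)
    (subP S K) : 'M_(1 + #|K|)).
Proof.
have l0 : lshift #|K| (ord0 : 'I_1) = ord0 :> 'I_#|K|.+1 by apply: val_inj.
congr (\det _); apply/(@matrixP _ (1 + #|K|) (1 + #|K|)) => a b.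
have -> : subX S i j K a b = S (bidx i a) (bidx j b) by rewrite mxE.
case: (split_ordP a) => a' ->; case: (split_ordP b) => b' ->.
- rewrite block_mxEul mxE !ord1 eqxx mulr1n.
  by rewrite l0 !bidx0.
- rewrite block_mxEur mxE !ord1 rshift1 bidxS.
  by rewrite l0 !bidx0.
- rewrite block_mxEdl mxE !ord1 rshift1 bidxS.
  by rewrite l0 !bidx0.
- by rewrite block_mxEdr mxE !rshift1 !bidxS.
Qed.

(** The unipotent [T] subtracts from column [j] its combination of the columns of [K], leaving only
    the corner entry. *)
Lemma det_subX_schur S i j K (v : 'I_n -> R) :
  (forall a, a \in K -> S a j = \sum_(b in K) S a b * v b) ->
  \det (subX S i j K) = (S i j - \sum_(b in K) S i b * v b) * \det (subP S K).
Proof.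
move=> H; pose c : 'cV[R]_#|K| := \col_b v (sidx b).
pose T : 'M[R]_(1 + #|K|) := block_mx 1%:M 0 (- c) 1%:M.
have dT : \det T = 1 by rewrite det_lblock !det1 mulr1.
rewrite det_subX_block -[LHS]mulr1 -dT -det_mulmx /T mulmx_block.
rewrite !mulmx1 !mulmx0 !add0r (_ : _ + subP S K *m _ = 0); last first.
  apply/colP => a; rewrite !mxE H ?sidxP // -sum_sidx.
  by rewrite -big_split big1 //= => b _; rewrite !mxE mulrN subrr.
rewrite det_ublock det_mx11 !mxE eqxx mulr1n; congr ((_ + _) * _).
rewrite -sum_sidx -sumrN.
by apply: eq_bigr => b _; rewrite !mxE mulrN.
Qed.

(** Cramer's rule: [T], of determinant [v i], turns column [i] into column [j]. *)
Lemma det_subX_cramer S i j K (v : 'I_n -> R) :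
  (forall a, a \in i |: K -> S a j = S a i * v i + \sum_(b in K) S a b * v b) ->
  \det (subX S i j K) = \det (subX S i i K) * v i.
Proof.
move=> H; pose c : 'cV[R]_#|K| := \col_b v (sidx b).
pose T : 'M[R]_(1 + #|K|) := block_mx (v i)%:M 0 c 1%:M.
have dT : \det T = v i by rewrite det_lblock det1 mulr1 det_mx11 mxE eqxx.
rewrite !det_subX_block -[in RHS]dT -det_mulmx; congr (\det _).
rewrite /T mulmx_block !mulmx1 !mulmx0 !add0r; congr block_mx.
- apply/matrixP => a b; rewrite !ord1 !mxE big_ord1 !mxE !eqxx !mulr1n.
  rewrite H ?setU11 // -sum_sidx; congr (_ + _).
  by apply: eq_bigr => k _; rewrite !mxE.
- apply/colP => a; rewrite !mxE big_ord1 !mxE eqxx mulr1n.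
  rewrite H ?in_setU1 ?sidxP ?orbT // -sum_sidx; congr (_ + _).
  by apply: eq_bigr => k _; rewrite !mxE.
Qed.

Lemma lambda_cond_normal S i j A (v : 'I_n -> R) : i \in A ->
  \det (subP S A) != 0 ->
  (forall a, a \in A -> S a j = \sum_(b in A) S a b * v b) ->
  lambda_cond S i j A = v i.
Proof.
move=> iA dA H; have eA : i |: (A :\ i) = A by rewrite setD1K.
rewrite /lambda_cond (@det_subX_cramer _ _ _ _ v); last first.
  move=> a; rewrite eA => /H->; rewrite (big_setD1 i) //.
by rewrite det_subX_diag ?eA ?setD11 // mulrAC mulfV ?mul1r.
Qed.

Lemma omega_cond_normal S i A (v : 'I_n -> R) : i \notin A ->
  \det (subP S A) != 0 ->
  (forall a, a \in A -> S a i = \sum_(b in A) S a b * v b) ->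
  omega_cond S i A = S i i - \sum_(b in A) S i b * v b.
Proof.
move=> iA dA H.
by rewrite /omega_cond -det_subX_diag // (det_subX_schur _ H) mulfK.
Qed.

(** * The Gaussian model *)

(** Positive definiteness: a kernel vector, extended by 0 to [x], makes a sum of squares with
    weights [w] vanish, so [x *m N^T = 0]. A general [N] serves for both covariance and precision
    matrices. *)
Lemma gram_subP_neq0 (w : 'I_n -> R) (N : 'M[R]_n) A :
  (forall i, 0 < w i) -> N \in unitmx ->
  \det (subP (N^T *m Omega w *m N) A) != 0.
Proof.
move=> w0 uN; set S := _ *m N; apply: det_subP_neq0 => v H a aA.
pose x : 'rV[R]_n := \row_b (if b \in A then v b else 0).
have xS b : (x *m S) 0 b = \sum_(a in A) v a * S a b.
  rewrite mxE [RHS]big_mkcond; apply: eq_bigr => c _; rewrite [x 0 c]mxE.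
  by case: ifP => // _; rewrite mul0r.
have xSx : (x *m S *m x^T) 0 0 = 0.
  rewrite mxE big1 // => b _; rewrite xS [x^T b 0]mxE [x 0 b]mxE; case: ifP => bA.
    by rewrite H // mul0r.
  by rewrite mulr0.
pose u := x *m N^T.
have uE : x *m S *m x^T = u *m Omega w *m u^T.
  by rewrite /u /S trmx_mul trmxK !mulmxA.
have u0 : u = 0.
  move: xSx; rewrite uE mxE => /eqP.
  have e b : (u *m Omega w) 0 b * u^T b 0 = w b * u 0 b ^+ 2.
    by rewrite mul_mx_diag !mxE expr2 mulrA (mulrC (w b)).
  under eq_bigr => b _ do rewrite e.
  rewrite psumr_eq0 => [/allP h|b _]; last by rewrite mulr_ge0 ?sqr_ge0 // ltW.
  apply/rowP => b; have := h b (mem_index_enum b).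
  by rewrite /= mulf_eq0 gt_eqF // sqrf_eq0 [RHS]mxE => /eqP.
have x0 : x = 0.
  have uN' : N^T \in unitmx by rewrite unitmx_tr.
  by rewrite -(mulmxK uN' x) -/u u0 mul0mx.
by have /rowP/(_ a) := x0; rewrite !mxE aA.
Qed.

(** For acyclic [L], the entry at [a], [b] sums the products of weights along the directed paths
    from [a] to [b]. *)
Definition effect (L : 'M[R]_n) := invmx (1%:M - L).

Section Covariance.
Variables (E : rel 'I_n) (w : 'I_n -> R) (L : 'M[R]_n).
Hypotheses (dE : dag E) (pE : param E w L).

Lemma param_supp a b : L a b != 0 -> E a b.
Proof. by apply: contraNT => /pE.2->. Qed.

(** If [v = v *m L], then [v] at [b] is a combination of its values at the parents of [b], so [v]
    vanishes by induction along the arrows. *)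
Lemma sub1_unit : 1%:M - L \in unitmx.
Proof.
rewrite unitmxE unitfE; apply/det0P => -[v vn0]; rewrite mulmxBr mulmx1.
move=> /eqP; rewrite subr_eq0 => /eqP vL; case/eqP: vn0; apply/rowP.
apply: (dag_ind dE) => b IHb; rewrite vL !mxE big1 // => c _.
have [/IHb->|/pE.2->] := boolP (E c b); by rewrite ?mxE ?mul0r ?mulr0.
Qed.

Lemma effectE a b : effect L a b = (a == b)%:R + \sum_c effect L a c * L c b.
Proof.
have := mulVmx sub1_unit; rewrite -/(effect L) mulmxBr mulmx1.
move=> /(canRL (subrK _))/matrixP/(_ a b) ->.
by rewrite !mxE.
Qed.

Lemma effect_connect a b : effect L a b != 0 -> connect E a b.
Proof.
move: b; apply: (dag_ind dE) => b IHb.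
have [->|nab] := eqVneq a b; first by rewrite connect0.
rewrite effectE (negbTE nab) add0r; apply: contra_neqT => ncab.
apply: big1 => c _; have [Ecb|/pE.2->] := boolP (E c b); last by rewrite mulr0.
have [->|/(IHb _ Ecb) ac] := eqVneq (effect L a c) 0; first by rewrite mul0r.
by rewrite (connect_trans ac (connect1 Ecb)) in ncab.
Qed.

Lemma effect_eq0 a b : ~~ connect E a b -> effect L a b = 0.
Proof. by apply: contraNeq; apply: effect_connect. Qed.

Lemma effect_diag a : effect L a a = 1.
Proof.
rewrite effectE eqxx big1 ?addr0 // => c _.
have [/dE/effect_eq0->|/pE.2->] := boolP (E c a); by rewrite ?mul0r ?mulr0.
Qed.

Lemma phiE a b : phi w L a b = \sum_c effect L c a * w c * effect L c b.
Proof.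
rewrite /phi mxE; apply: eq_bigr => c _.
by rewrite /Omega mul_mx_diag !mxE.
Qed.

Lemma phiC a b : phi w L a b = phi w L b a.
Proof. by rewrite !phiE; apply: eq_bigr => c _; rewrite mulrC [_ * w c]mulrC mulrA. Qed.

(** The structural equation of [X_b], paired with [X_a]; the last term is the covariance of [X_a]
    with the noise of [b]. *)
Lemma phi_rec a b :
  phi w L a b = \sum_c phi w L a c * L c b + effect L b a * w b.
Proof.
rewrite phiE; under eq_bigr => c _ do rewrite (effectE c b) mulrDr mulr_sumr.
rewrite big_split /= addrC exchange_big /=; congr (_ + _).
  apply: eq_bigr => c _; rewrite phiE mulr_suml.
  by apply: eq_bigr => d _; rewrite mulrA.
rewrite (bigD1 b) //= eqxx mulr1 big1 ?addr0 // => c /negbTE->.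
by rewrite mulr0.
Qed.

Lemma phi_eq0 a b : ~~ common_anc E a b -> phi w L a b = 0.
Proof.
move=> nc; rewrite phiE big1 // => c _.
have [ca|/effect_eq0->] := boolP (connect E c a); last by rewrite !mul0r.
rewrite (@effect_eq0 c b) ?mulr0 //; apply: contra nc => cb.
by apply/existsP; exists c; rewrite ca.
Qed.

Lemma phi_subP_neq0 A : \det (subP (phi w L) A) != 0.
Proof. by apply: gram_subP_neq0 pE.1 _; rewrite unitmx_inv sub1_unit. Qed.

End Covariance.

(** Directed paths that end in the ancestral set [B] never leave it. *)
Lemma effect_eq_in (E : rel 'I_n) (w w' : 'I_n -> R) (L L' : 'M[R]_n)
  (B : pred 'I_n) : dag E -> param E w L -> param E w' L' ->
  (forall a b, E a b -> B b -> B a) ->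
  (forall a b, B b -> L a b = L' a b) ->
  forall a b, B b -> effect L a b = effect L' a b.
Proof.
move=> dE pL pL' Bcl LL' a; apply: (dag_ind dE) => b IHb Bb.
rewrite (effectE dE pL) (effectE dE pL'); congr (_ + _); apply: eq_bigr => c _.
rewrite LL' //; have [Ecb|nE] := boolP (E c b); last by rewrite pL'.2 // !mulr0.
by rewrite IHb //; apply: Bcl Ecb Bb.
Qed.

Lemma phi_eq_in (E : rel 'I_n) (w : 'I_n -> R) (L L' : 'M[R]_n)
  (B : pred 'I_n) : dag E ->
  param E w L -> param E w L' ->
  (forall a b, E a b -> B b -> B a) ->
  (forall a b, B b -> L a b = L' a b) ->
  forall a b, B a -> B b -> phi w L a b = phi w L' a b.
Proof.
move=> dE pL pL' Bcl LL' a b Ba Bb; rewrite !phiE; apply: eq_bigr => c _.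
by rewrite !(effect_eq_in dE pL pL' Bcl LL').
Qed.

(** * Unit weights on a subgraph *)

Definition indic (F : rel 'I_n) : 'M[R]_n := \matrix_(a, b) (F a b)%:R.

Lemma indicE F a b : indic F a b = (F a b)%:R.
Proof. by rewrite mxE. Qed.

Lemma param_indic (E F : rel 'I_n) (w : 'I_n -> R) : subrel F E -> (forall i, 0 < w i) ->
  param E w (indic F).
Proof.
move=> FE w0; split=> // a b nE; rewrite indicE.
by rewrite (contraNF (@FE a b) nE).
Qed.

Section Indicator.
Variables (F : rel 'I_n) (w : 'I_n -> R).
Hypotheses (dF : dag F) (w0 : forall i, 0 < w i).

Let pF : param F (fun=> 1) (indic F).
Proof. by apply: param_indic => // i; apply: ltr01. Qed.

Lemma effect_indic_ge0 a b : 0 <= effect (indic F) a b.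
Proof.
move: b; apply: (dag_ind dF) => b IHb; rewrite (effectE dF pF).
rewrite addr_ge0 ?ler0n // sumr_ge0 // => c _.
rewrite mxE; case: (boolP (F c b)) => [/IHb|_]; first by rewrite mulr1.
by rewrite mulr0.
Qed.

Lemma effect_indic_gt0 a b : connect F a b -> 0 < effect (indic F) a b.
Proof.
move: b; apply: (dag_ind dF) => b IHb cab.
have [<-|nab] := eqVneq a b; first by rewrite (effect_diag dF pF) ltr01.
have [c ac Fcb] := connect_last cab nab.
rewrite (effectE dF pF) (bigD1 c) //= mxE Fcb mulr1.
rewrite ltr_wpDl ?ler0n // ltr_wpDr ?IHb // sumr_ge0 // => d _.
by rewrite mulr_ge0 ?effect_indic_ge0 // mxE ler0n.
Qed.

(** Nonnegative weights exclude cancellation, so each common ancestor forces a positive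
    covariance. *)
Lemma phi_indic_gt0 a b : common_anc F a b -> 0 < phi w (indic F) a b.
Proof.
case/existsP => c /andP[ca cb]; rewrite phiE (bigD1 c) //= ltr_wpDr //.
  rewrite sumr_ge0 // => d _.
  by rewrite !mulr_ge0 ?effect_indic_ge0 // ltW.
by rewrite !mulr_gt0 ?effect_indic_gt0.
Qed.

End Indicator.

(** * The global Markov property and its converse *)

(* With the columns of L outside An erased, the precision matrix Q vanishes
   between U and the complement of U and K, so that the solution y of Qy = e_i
   supported in U gives a vector Qy, supported in i and K, in the kernel. *)
Lemma dsep_det0 (E : rel 'I_n) (w : 'I_n -> R) (L : 'M[R]_n) i j K :
  dag E -> param E w L ->
  i != j -> i \notin K -> j \notin K ->
  dsep E K [set i] [set j] -> \det (subX (phi w L) i j K) = 0.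
Proof.
move=> dE pL ij iK jK /(dsep_moral dE ij iK jK).
set An := sub_anc _ _ => -[U [iU jU dUK Ucl]].
have Anp a b : E a b -> b \in An -> a \in An.
  by move=> /connect1; apply: sub_anc_connect.
(* The erasure keeps the covariances on [An] and removes the entries of [Q] due to common children
   outside [An]. *)
pose L0 : 'M[R]_n := \matrix_(a, b) if b \in An then L a b else 0.
have pL0 : param E w L0.
  by split=> [|a b nE]; [exact: pL.1 | rewrite mxE pL.2 // if_same].
have SS0 a b : a \in An -> b \in An -> phi w L a b = phi w L0 a b.
  apply: (phi_eq_in (B := mem An) dE pL pL0) => //.
  by move=> x y yA; rewrite mxE; move: yA => /= ->.
pose N : 'M[R]_n := (1%:M - L0)^T.
pose w' a := (w a)^-1.
pose Q := N^T *m Omega w' *m N.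
have uN : N \in unitmx by rewrite unitmx_tr (sub1_unit dE pL0).
have w'0 a : 0 < w' a by rewrite invr_gt0 pL.1.
have WW : Omega w *m Omega w' = 1%:M.
  apply/matrixP => a b; rewrite /Omega mul_diag_mx !mxE.
  by case: eqP => [->|_]; rewrite ?mulr0 // !mulr1n mulfV // gt_eqF ?pL.1.
have SQ : phi w L0 *m Q = 1%:M.
  rewrite /phi /Q /N trmxK !mulmxA mulmxKV ?(sub1_unit dE pL0) //.
  rewrite -(mulmxA _ (Omega w)) WW mulmx1 -trmx_mul mulmxV ?trmx1 //.
  exact: sub1_unit pL0.
have N0 a b : N b a != 0 -> a != b -> E a b && (b \in An).
  rewrite !mxE => + /negbTE nab; rewrite nab sub0r oppr_eq0.
  by case: ifP => [_ /(param_supp pL) ->|]; rewrite ?eqxx.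
have QE a b : Q a b = \sum_c N c a * w' c * N c b.
  by rewrite mxE; apply: eq_bigr => c _; rewrite /Omega mul_mx_diag !mxE.
have Q0 a b : a \notin U -> a \notin K -> b \in U -> Q a b = 0.
  move=> aU aK bU; have nab : a != b by apply: contraNneq aU => ->.
  rewrite QE big1 // => c _; apply/eqP; apply: contraNT aU.
  rewrite !mulf_eq0 !negb_or => /andP[/andP[Na _] Nb].
  have [eca|nca] := eqVneq a c.
    rewrite -eca in Nb; rewrite eq_sym in nab.
    case/andP: (N0 _ _ Nb nab) => Eba aA.
    by apply: (Ucl b) => //; [apply: Anp Eba aA | left; rewrite /adj Eba].
  case/andP: (N0 _ _ Na nca) => Eac cA.
  have [ecb|ncb] := eqVneq b c.
    rewrite -ecb in Eac cA.
    by apply: (Ucl b) => //; [apply: Anp Eac cA | left; rewrite /adj Eac orbT].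
  case/andP: (N0 _ _ Nb ncb) => Ebc _.
  apply: (Ucl b) => //; [exact: Anp Ebc cA | exact: Anp Eac cA |].
  by right; exists c => //; rewrite Ebc.
have [z zE] := subP_solve (fun a => (a == i)%:R) (gram_subP_neq0 U w'0 uN).
pose y : 'cV[R]_n := \col_b if b \in U then z b else 0.
pose v := Q *m y.
have vE a : v a 0 = \sum_(b in U) Q a b * z b.
  rewrite mxE [RHS]big_mkcond; apply: eq_bigr => b _; rewrite [y b 0]mxE.
  by case: ifP => // _; rewrite mulr0.
have vi : v i 0 = 1 by rewrite vE -zE // eqxx.
have v0 a : a \notin i |: K -> v a 0 = 0.
  rewrite in_setU1 negb_or => /andP[ai aK]; rewrite vE.
  have [aU|aU] := boolP (a \in U); first by rewrite -zE // (negbTE ai).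
  by rewrite big1 // => b bU; rewrite Q0 // mul0r.
have KA a : a \in i |: (j |: K) -> a \in An by apply: sub_sub_anc.
apply: (@det_subX_eq0 _ _ _ _ (fun a => v a 0)); first by rewrite vi oner_eq0.
move=> b bjK.
have bA : b \in An by apply: KA; rewrite in_setU1 bjK orbT.
have -> : v i 0 * phi w L i b = v i 0 * phi w L0 i b.
  by rewrite SS0 // KA // setU11.
have KA' a : a \in K -> a \in An by move=> aK; rewrite KA // !in_setU1 aK !orbT.
under eq_bigr => a aK do rewrite (SS0 _ _ (KA' _ aK) bA).
rewrite -(sum_supp (F := fun a => v a 0 * phi w L0 a b)) //; last first.
  by move=> a /v0->; rewrite mul0r.
(* [y] vanishes outside [U], hence at [j] and on [K]: these are the kernel equations. *)
have /colP/(_ b) : phi w L0 *m v = y by rewrite mulmxA SQ mul1mx.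
rewrite !mxE => e; under eq_bigr => a _ do rewrite phiC mulrC.
rewrite e; case: ifP => // bU.
case/setU1P: bjK => [bj|bK]; first by rewrite -bj bU in jU.
by rewrite (disjointFr dUK bU) in bK.
Qed.

Lemma det0_dsep (E : rel 'I_n) i j K : dag E ->
  i != j -> i \notin K -> j \notin K ->
  (forall (w : 'I_n -> R) (L : 'M[R]_n), param E w L ->
     \det (subX (phi w L) i j K) = 0) ->
  dsep E K [set i] [set j].
Proof.
move=> dE ij iK jK det0 x y p /set1P-> /set1P-> {x y} ip.
(* Decided by searching the finitely many positions on the path. *)
have [//|nb] : blocked E K i p \/ ~ blocked E K i p.
  pose b k := let u := nth i p k.-1 in let v := nth i p k in
    let w := nth i p k.+1 in (0 < k)%N &&
    ((~~ collider E u v w && (v \in K)) ||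
    [&& collider E u v w, v \notin K & [disjoint de E v & K]]).
  have [/hasP[k]|/hasP h] := boolP (has b (iota 0 (size p).-1)).
    by rewrite mem_iota => /andP[_ kp] /andP[k0 bk]; left; exists k.
  right=> -[k [k0 kp bk]]; apply: h; exists k; first by rewrite mem_iota.
  by rewrite /b k0.
have := unblocked_trek dE ij iK jK ip nb.
(* The chain is reversed, since the elimination below starts at [j], where [v] vanishes. *)
rewrite (sym_connect_sym (@trek_rel_sym _ E K i j)).
case/connectP => q0 /induced_path[q [qp ql qi qn _]] qi0.
rewrite -ql {ql q0} in qi0.
pose P := [pred x | x \in j :: q].
pose F := only_entry E K P.
have FE : subrel F E by apply: only_entry_sub.
have dF := dag_sub FE dE.
pose S : 'M[R]_n := phi (fun=> 1) (indic F).
have w0 : forall k : 'I_n, 0 < (1 : R) by move=> _; apply: ltr01.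
have pF : param F (fun=> 1) (indic F) by apply: param_indic.
suff: \det (subX S i j K) != 0.
  by rewrite det0 ?eqxx //; apply: param_indic.
apply: det_subX_neq0 => // v0 H0.
pose v a := if a \in i |: K then v0 a else 0.
have vK a : a \notin i |: K -> v a = 0 by rewrite /v => /negbTE->.
have H b : b \in j |: K -> \sum_a v a * S a b = 0.
  move=> bK; rewrite (sum_supp (i := i) (K := K)) //; last first.
    by move=> a /vK->; rewrite mul0r.
  rewrite -[RHS](H0 b bK) /v setU11; congr (_ + _).
  by apply: eq_bigr => a aK; rewrite in_setU1 aK orbT.
suff v_eq0 : forall a, a \in i |: K -> v a = 0.
  by move=> a aK; have := v_eq0 a aK; rewrite /v aK.
have Spos a b : trek_rel E K i j a b -> P a -> P b -> 0 < S a b.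
  case/and3P => _ _ /existsP[c /andP[ca cb]] Pa Pb.
  apply: phi_indic_gt0 => //; apply/existsP; exists c.
  by rewrite !(connect_only_entry (P := P)) // ?Pa ?Pb orbT.
(* Vertices of [K] off the induced path are isolated in [F]. *)
have Soff a b : a \in K -> ~~ P a -> a != b -> S a b = 0.
  move=> aK aP nab; apply: (phi_eq0 dF pF); apply: contra nab.
  move=> /common_anc_isolated-> // u; first exact: only_entry_into.
  exact: only_entry_from.
have Snon a b : a \in i |: (j |: K) -> b \in i |: (j |: K) ->
    ~~ trek_rel E K i j a b -> S a b = 0.
  rewrite /trek_rel => -> -> /= nab; apply: (phi_eq0 dF pF).
  apply: contra nab => /existsP[c /andP[ca cb]]; apply/existsP; exists c.
  by apply/andP; split; [move: ca | move: cb]; apply: connect_sub => x y /andP[xy _];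
     apply: connect1.
pose X := i |: (j |: K).
have trekX a b : trek_rel E K i j a b -> (a \in X) && (b \in X).
  by case/and3P => -> ->.
have jX : j \in X by rewrite !inE eqxx orbT.
have vj : v j = 0 by apply: vK; rewrite in_setU1 negb_or eq_sym ij.
(* Triangular elimination along the induced path, starting from j. *)
have elim_path : forall q1 q2 x, j :: q = rcons q1 x ++ q2 -> x \in X ->
    (forall y, y \in rcons q1 x -> v y = 0) ->
    path (trek_rel E K i j) x q2 -> induced (trek_rel E K i j) x q2 ->
    i = last x q2 -> i \notin belast x q2 -> forall y, y \in q2 -> v y = 0.
  move=> q1 q2; elim: q2 q1 => [//|z q2 IHq] q1 x eqq xX vz /= /andP[xz pz].
  move=> /andP[/allP nx iz] ei; rewrite inE negb_or => /andP[xi iq].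
  have zX : z \in X by case/andP: (trekX _ _ xz).
  have inP y : P y = [|| y \in rcons q1 x, y == z | y \in q2].
    by rewrite /P /= eqq mem_cat in_cons.
  have Px : P x by rewrite [P x]inP mem_rcons mem_head.
  have Pz : P z by rewrite [P z]inP eqxx orbT.
  have xK : x \in j |: K by move: xX; rewrite in_setU1 eq_sym (negbTE xi).
  have Szx : 0 < S z x by apply: Spos => //; rewrite trek_rel_sym.
  (* In the equation at [x], [v] is 0 at [x] and at the earlier vertices, and [S] is 0 at those
     after [z]: only the term of [z] remains. *)
  have vz0 : v z = 0.
    have /eqP := H x xK; rewrite (bigD1 z) //= big1 ?addr0.
      by rewrite mulf_eq0 (gt_eqF Szx) orbF => /eqP.
    move=> a az; have [aX|aX] := boolP (a \in i |: K); last first.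
      by rewrite vK // mul0r.
    have [Pa|Pa] := boolP (P a); last first.
      rewrite Soff ?mulr0 //; last by apply: contraNneq Pa => ->.
      move: aX; rewrite in_setU1 => /orP[/eqP ai|//].
      by move: Pa; rewrite [P a]inP -in_cons ai ei mem_last orbT.
    move: Pa; rewrite [P a]inP (negbTE az) => /orP[/vz->|/nx nxa].
      by rewrite mul0r.
    rewrite Snon ?mulr0 //; last by rewrite trek_rel_sym.
    by move: aX; rewrite !in_setU1 => /orP[]->; rewrite ?orbT.
  have vz1 y : y \in rcons (rcons q1 x) z -> v y = 0.
    by rewrite mem_rcons inE => /orP[/eqP->|/vz].
  move=> y; rewrite inE => /orP[/eqP->//|].
  by apply: (IHq (rcons q1 x) z _ zX vz1 pz iz ei iq); rewrite cat_rcons -eqq.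
have vP a : P a -> v a = 0.
  rewrite /P /= inE => /orP[/eqP->//|].
  apply: (elim_path [::] q j) => //; last by rewrite qi0.
  by move=> y; rewrite inE => /eqP->.
move=> a aiK; have [/vP//|Pa] := boolP (P a).
have aK : a \in K.
  move: aiK; rewrite in_setU1 => /orP[/eqP ai|//].
  by move: Pa; rewrite /P /= ai qi0 mem_last.
(* Off the path, the equation at [a] has the single term [v a * S a a]. *)
have Saa : 0 < S a a by apply: phi_indic_gt0 => //; apply: common_anc_refl.
have /eqP : \sum_b v b * S b a = 0 by apply: H; rewrite in_setU1 aK orbT.
rewrite (bigD1 a) //= big1 ?addr0.
  by rewrite mulf_eq0 (gt_eqF Saa) orbF => /eqP.
by move=> b ba; rewrite [S b a]phiC // Soff ?mulr0 // eq_sym.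
Qed.

End Minors.

(** * Conditional parameters *)

Section ConditionalParameters.
Variables (R : realType) (n : nat) (E : rel 'I_n).
Hypothesis dE : dag E.
Implicit Types (i j : 'I_n) (A : {set 'I_n}) (w : 'I_n -> R) (L : 'M[R]_n).

(** Both directions of the Markov property, with a nonzero denominator. It is applied to the given
    graph and to [Gdel E i j]. *)
Lemma lambda_cond_dsep i j A : i != j -> j \notin A ->
  (forall S : 'M[R]_n, inM E S -> lambda_cond S i j A = 0) <->
  dsep E (A :\ i) [set i] [set j].
Proof.
move=> ij jA; have iK : i \notin A :\ i by rewrite setD11.
have jK : j \notin A :\ i by rewrite in_setD1 (negbTE jA) andbF.
split=> [l0|sep _ [w [L [pL ->]]]]; last first.
  by rewrite /lambda_cond (dsep_det0 dE pL) ?mul0r.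
apply: (det0_dsep (R := R) dE ij iK jK) => w L pL.
have /eqP := l0 _ (ex_intro _ w (ex_intro _ L (conj pL erefl))).
by rewrite mulf_eq0 invr_eq0 (negbTE (phi_subP_neq0 dE pL A)) orbF => /eqP.
Qed.

(** * When the conditional variance is the noise variance *)

Lemma ltr01_cst : forall i : 'I_n, 0 < (1 : R).
Proof. by move=> _; apply: ltr01. Qed.

(** Column [i] of [L] solves the normal equations, since the noise of [i] is uncorrelated with its
    non-descendants. *)
Lemma omega_cond_parents i A w L : i \notin A -> pa E i \subset A ->
  A \subset ~: dbar E i -> param E w L -> omega_cond (phi w L) i A = w i.
Proof.
move=> iA /subsetP paA /subsetP Ade pL.
have supp a : \sum_c phi w L a c * L c i = \sum_(b in A) phi w L a b * L b i.
  rewrite [RHS]big_mkcond; apply: eq_bigr => b _; case: ifP => // bA.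
  rewrite pL.2 ?mulr0 //; apply/negP => Ebi.
  by rewrite paA // inE in bA.
rewrite (omega_cond_normal (v := fun b => L b i) iA (phi_subP_neq0 dE pL A)).
  rewrite (phi_rec dE pL) supp addrAC subrr add0r.
  by rewrite (effect_diag dE pL) mul1r.
move=> a aA; rewrite (phi_rec dE pL) supp (effect_eq0 dE pL) ?mul0r ?addr0 //.
have := Ade a aA; rewrite !inE negb_or negb_and negbK => /andP[ai].
by rewrite (negbTE ai).
Qed.

(* Only the arrow k -> i is switched on. *)
Lemma omega_cond_pa i A : i \notin A ->
  (forall w L, param E w L -> omega_cond (phi w L) i A = w i) ->
  pa E i \subset A.
Proof.
move=> iA H; apply/subsetP => k; rewrite inE => Eki; apply: contraT => kA.
pose F : rel 'I_n := fun u v => (u, v) == (k, i).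
have FE : subrel F E by move=> u v /eqP[-> ->].
have dF := dag_sub FE dE.
have pF := param_indic (F := F) (fun _ _ => id) ltr01_cst.
have S0 a : a \in A -> phi (fun=> 1 : R) (indic R F) a i = 0.
  move=> aA; apply: (phi_eq0 dF pF); apply/existsP => -[c /andP[ca ci]].
  have eca : c = a.
    apply/eqP; apply: contraT => /(connect_last ca)[x _ /eqP[_ ai]].
    by rewrite ai (negbTE iA) in aA.
  subst c; have nai : a != i by apply: contraNneq iA => <-.
  have [x /eqP[ak _] _] := connect_head ci nai.
  by rewrite ak (negbTE kA) in aA.
have := H _ _ (param_indic FE ltr01_cst).
rewrite (omega_cond_normal (v := fun=> 0) iA (phi_subP_neq0 dF pF A)); last first.
  by move=> a aA; rewrite S0 // big1 // => b _; rewrite mulr0.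
rewrite big1 ?subr0 => [|b _]; last by rewrite mulr0.
(* The conditional variance is [S i i = S i k + 1]; its being 1 contradicts [S i k > 0]. *)
rewrite (phi_rec dF pF) (effect_diag dF pF) mulr1 -[RHS]add0r => /addIr/eqP.
rewrite (bigD1 k) //= big1 ?addr0 => [|c /negbTE nck]; last first.
  by rewrite indicE /F xpair_eqE nck mulr0.
rewrite indicE /F eqxx mulr1 gt_eqF //; apply: phi_indic_gt0 => //.
rewrite common_ancC; apply: common_anc_connect; apply: connect1.
by rewrite /F eqxx.
Qed.

(** Makes [i] a source while keeping every directed path that starts there. *)
Definition below i : rel 'I_n := fun u v => E u v && connect E i u.

Lemma connect_below i v : connect E i v -> connect (below i) i v.
Proof.
case/connectP => p + ->; elim/last_ind: p => [|p x IHp] //=.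
rewrite rcons_path last_rcons => /andP[pp Ex].
apply: connect_trans (IHp pp) (connect1 _); rewrite /below Ex /=.
by apply/connectP; exists p.
Qed.

Lemma below_root i u : below i u i = false.
Proof. by apply/negP => /andP[/dE/negbTE->]. Qed.

Lemma below_first i A : ~~ [disjoint de E i & A] -> i \notin A ->
  exists2 k, k \in A & connect (only_entry (below i) A (pred1 k)) i k.
Proof.
move=> /pred0Pn[k0 /=]; rewrite inE => /andP[/andP[_ ik0] k0A] iA.
have [k kA ik] := connect_noexit_first (connect_below ik0) k0A.
by exists k => //; apply: connect_only_entry ik; rewrite /= eqxx orbT.
Qed.

Lemma subset_nondesc i A : i \notin A -> [disjoint de E i & A] ->
  A \subset ~: dbar E i.
Proof.
move=> iA dA; apply/subsetP => a aA; rewrite in_setC in_setU1 negb_or.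
rewrite (disjointFl dA aA) andbT.
by apply: contraNneq iA => <-.
Qed.

(* k is the only vertex of A that is correlated with i. *)
Lemma omega_cond_nondesc i A : i \notin A ->
  (forall w L, param E w L -> omega_cond (phi w L) i A = w i) ->
  A \subset ~: dbar E i.
Proof.
move=> iA H; apply: subset_nondesc => //; apply: contraT.
move=> /below_first/(_ iA)[k kA].
set F := only_entry _ _ _ => ik.
have FE : subrel F E by move=> u v /only_entry_sub/andP[].
have dF := dag_sub FE dE.
have pF := param_indic (F := F) (fun _ _ => id) ltr01_cst.
have Sik : 0 < phi (fun=> 1 : R) (indic R F) i k.
  apply: phi_indic_gt0 => //.
  exact: common_anc_connect.
have S0 b x : b \in A -> b != k -> x != b ->
    phi (fun=> 1 : R) (indic R F) x b = 0.
  move=> bA bk xb; rewrite phiC; apply: (phi_eq0 dF pF); apply: contra xb.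
  move=> /common_anc_isolated-> // u; first exact: only_entry_into.
  exact: only_entry_from.
have Sii : phi (fun=> 1 : R) (indic R F) i i = 1.
  rewrite (phi_rec dF pF) (effect_diag dF pF) mulr1 big1 ?add0r // => c _.
  by rewrite indicE /F /only_entry /noexit below_root mulr0.
have [v vE] := subP_solve (fun a => phi (fun=> 1) (indic R F) a i)
  (phi_subP_neq0 dF pF A).
have := H _ _ (param_indic FE ltr01_cst).
rewrite (omega_cond_normal iA (phi_subP_neq0 dF pF A) vE) Sii.
rewrite (bigD1 k) //= big1 ?addr0 => [|b /andP[bA bk]]; last first.
  by rewrite S0 ?mul0r //; apply: contraNneq iA => ->.
(* From [1 - S i k * v k = 1] follows [v k = 0], and the normal equation at [k] then gives
   [S k i = 0]. *)
move=> /eqP; rewrite subr_eq -subr_eq0 opprD addrA subrr sub0r oppr_eq0.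
rewrite mulf_eq0 (gt_eqF Sik) /= => /eqP vk.
have /eqP := vE k kA; rewrite big1 => [|b bA].
  by rewrite phiC (gt_eqF Sik).
have [->|bk] := eqVneq b k; first by rewrite vk mulr0.
by rewrite S0 ?mul0r // eq_sym.
Qed.

(** * When the conditional coefficient is the edge weight *)

Lemma lambda_cond_mem i j A : E i j -> j \notin A ->
  (forall w L, param E w L -> lambda_cond (phi w L) i j A = L i j) -> i \in A.
Proof.
move=> Eij jA H; apply: contraT => iA.
pose F : rel 'I_n := fun u v => (u, v) == (i, j).
have FE : subrel F E by move=> u v /eqP[-> ->].
have dF := dag_sub FE dE.
(* For [i] outside [A], [lambda_cond] is a conditional covariance, here equal to the variance of
   [i]; the value 2 separates it from the weight 1. *)
have w0 : forall k : 'I_n, 0 < (2 : R) by move=> _; apply: ltr0n.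
have pF := param_indic (F := F) (fun _ _ => id) w0.
have S0 a : a \in A -> phi (fun=> 2 : R) (indic R F) a j = 0.
  move=> aA; apply: (phi_eq0 dF pF); apply: contra (jA).
  have [aj ai] : a != j /\ a != i.
    by split; [apply: contraNneq jA | apply: contraNneq iA] => <-.
  move=> /common_anc_isolated <- // u; rewrite /F xpair_eqE.
    by rewrite (negbTE aj) andbF.
  by rewrite (negbTE ai).
have := H _ _ (param_indic FE w0).
have -> : lambda_cond (phi (fun=> 2 : R) (indic R F)) i j A =
    phi (fun=> 2 : R) (indic R F) i j.
  have eA : A :\ i = A.
    by apply/setDidPl; rewrite disjoint_sym disjoints1.
  rewrite /lambda_cond eA (det_subX_schur _ (v := fun=> 0)).
    rewrite mulfK ?(phi_subP_neq0 dF pF) // big1 ?subr0 // => b _.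
    by rewrite mulr0.
  by move=> a aA; rewrite S0 // big1 // => b _; rewrite mulr0.
have nij : i != j by apply: contraTneq Eij => ->; apply/negP => /dE; rewrite connect0.
have nji : ~~ connect F j i.
  by apply: dF; rewrite /F eqxx.
rewrite (phi_rec dF pF) (effect_eq0 dF pF nji) mul0r addr0.
rewrite (bigD1 i) //= big1 ?addr0 => [|c /negbTE nci]; last first.
  by rewrite indicE /F xpair_eqE nci mulr0.
rewrite indicE /F eqxx mulr1 (phi_rec dF pF) (effect_diag dF pF) mul1r big1.
  by rewrite add0r => /eqP; rewrite eqr_nat.
by move=> c _; rewrite indicE /F xpair_eqE (negbTE nij) andbF mulr0.
Qed.

(* If the coefficient of i were right, then that of k would vanish, leaving the
   effect of j on k unexplained. *)
Lemma lambda_cond_nondesc i j A : E i j -> i \in A -> j \notin A ->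
  (forall w L, param E w L -> lambda_cond (phi w L) i j A = L i j) ->
  A \subset ~: dbar E j.
Proof.
move=> Eij iA jA H; apply: subset_nondesc => //; apply: contraT.
move=> /below_first/(_ jA)[k kA].
set F0 := only_entry _ _ _ => jk0.
pose F : rel 'I_n := fun u v => F0 u v || ((u, v) == (i, j)).
have F0E : subrel F0 E by move=> u v /only_entry_sub/andP[].
have FE : subrel F E by move=> u v /orP[/F0E//|/eqP[-> ->]].
have dF := dag_sub FE dE.
have pF := param_indic (F := F) (fun _ _ => id) ltr01_cst.
have Fij : F i j by rewrite /F eqxx orbT.
have jk : connect F j k.
  by apply: connect_sub jk0 => u v uv; apply: connect1; rewrite /F uv.
have nij : i != j by apply: contraNneq jA => <-.
have nik : i != k.
  by apply: contraNneq (dF _ _ Fij) => ->.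
have Finj c : F c j = (c == i).
  rewrite /F /F0 /only_entry /noexit below_root xpair_eqE eqxx andbT.
  by [].
have Sik : 0 < phi (fun=> 1 : R) (indic R F) i k.
  apply: phi_indic_gt0 => //.
  by apply: common_anc_connect; apply: connect_trans (connect1 Fij) jk.
have S0 b x : b \in A -> b != k -> b != i -> x != b ->
    phi (fun=> 1 : R) (indic R F) x b = 0.
  move=> bA bk bi xb; rewrite phiC; apply: (phi_eq0 dF pF); apply: contra xb.
  have bj : b != j by apply: contraNneq jA => <-.
  move=> /common_anc_isolated-> // u; rewrite /F xpair_eqE.
    by rewrite [F0 _ _]only_entry_into // (negbTE bj) andbF.
  by rewrite [F0 _ _]only_entry_from // (negbTE bi).
have recj a : phi (fun=> 1 : R) (indic R F) a j =
    phi (fun=> 1 : R) (indic R F) a i + effect (indic R F) j a.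
  rewrite (phi_rec dF pF) mulr1 (bigD1 i) //= big1 => [|c /negbTE nci].
    by rewrite indicE Finj eqxx mulr1 addr0.
  by rewrite indicE Finj nci mulr0.
have [v vE] := subP_solve (fun a => phi (fun=> 1) (indic R F) a j)
  (phi_subP_neq0 dF pF A).
have := H _ _ (param_indic FE ltr01_cst).
rewrite (lambda_cond_normal iA (phi_subP_neq0 dF pF A) vE) indicE Fij => vi.
have sumE a : a \in [set i; k] ->
    \sum_(b in A) phi (fun=> 1 : R) (indic R F) a b * v b =
    phi (fun=> 1 : R) (indic R F) a i + phi (fun=> 1 : R) (indic R F) a k * v k.
  move=> aik; rewrite (bigD1 i) //= vi mulr1; congr (_ + _).
  rewrite (bigD1 k) /=; last by rewrite kA eq_sym.
  rewrite big1 ?addr0 // => b /andP[/andP[bA bi] bk].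
  rewrite S0 ?mul0r //.
  by case/set2P: aik => ->; rewrite eq_sym.
(* The noise of [j] does not reach [i], so the equation at [i] leaves [S i k * v k = 0]. *)
have /eqP vk : v k = 0.
  have := vE i iA; rewrite recj sumE ?set21 //.
  rewrite (effect_eq0 dF pF (dF _ _ Fij)) => /addrI/esym/eqP.
  by rewrite mulf_eq0 (gt_eqF Sik) => /eqP.
have := vE k kA; rewrite recj sumE ?set22 // (eqP vk) mulr0 => /addrI/eqP.
by rewrite gt_eqF // effect_indic_gt0.
Qed.

Lemma Gdel_sub i j : subrel (Gdel E i j) E.
Proof. by move=> u v /and4P[]. Qed.

Lemma Gdel_irr i j : Gdel E i j i j = false.
Proof. by rewrite /Gdel eqxx andbF. Qed.

(* Among the non-descendants of j, deleting the arrow i -> j subtracts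
   L i j * X_i from X_j and leaves the other variables unchanged. *)
Lemma lambda_cond_Gdel i j A w L : E i j -> i \in A -> A \subset ~: dbar E j ->
  param E w L ->
  exists2 L', param (Gdel E i j) w L' &
    lambda_cond (phi w L) i j A = lambda_cond (phi w L') i j A + L i j.
Proof.
move=> Eij iA /subsetP Ade pL; set G := Gdel E i j.
pose L' : 'M[R]_n := \matrix_(a, b) if G a b then L a b else 0.
have pL' : param G w L'.
  by split=> [|a b /negbTE nG]; [exact: pL.1 | rewrite mxE nG].
have dG : dag G := dag_sub (@Gdel_sub i j) dE.
have pLE' : param E w L'.
  split=> [|a b nE]; first exact: pL.1.
  by rewrite mxE pL.2 // if_same.
exists L' => //.
pose B : pred 'I_n := fun b => ~~ connect E j b.
have Bcl a b : E a b -> B b -> B a.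
  move=> Eab; apply: contra => ja; exact: connect_trans ja (connect1 Eab).
have deB b : B b -> b \notin de E j by rewrite /B inE negb_and => ->; rewrite orbT.
have LL' a b : B b -> L a b = L' a b.
  move=> Bb; rewrite mxE; case: ifP => // /negbT; rewrite /G /Gdel.
  have [Eab|/pL.2//] := boolP (E a b).
  rewrite /= (deB _ Bb) (deB _ (Bcl _ _ Eab Bb)) !andbT negbK.
  by move=> /eqP[_ bj]; rewrite bj /B connect0 in Bb.
have eB := effect_eq_in dE pL pLE' Bcl LL'.
have paB c : E c j -> B c by apply: dE.
have ej c : effect L c j = effect L' c j + effect L c i * L i j.
  rewrite (effectE dE pL) [in RHS](effectE dE pLE') -addrA; congr (_ + _).
  rewrite (bigD1 i) //= [in RHS](bigD1 i) //= [L' i j]mxE /G Gdel_irr mulr0 add0r.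
  rewrite addrC; congr (_ + _); apply: eq_bigr => d di.
  have [Edj|nE] := boolP (E d j); last first.
    by rewrite pL.2 // pLE'.2 // !mulr0.
  rewrite eB ?paB //; congr (_ * _); rewrite mxE /G /Gdel Edj xpair_eqE.
  by rewrite (negbTE di) (deB _ (paB _ Edj)) inE eqxx.
have AB a : a \in A -> B a.
  move=> /Ade; rewrite in_setC in_setU1 inE negb_or negb_and negbK.
  by case/andP=> /negbTE ->.
have SA a b : a \in A -> b \in A -> phi w L a b = phi w L' a b.
  by move=> aA bA; apply: (phi_eq_in dE pL pLE' Bcl LL'); apply: AB.
have Sj a : a \in A -> phi w L a j = phi w L' a j + phi w L a i * L i j.
  move=> aA; rewrite !phiE mulr_suml -big_split /=; apply: eq_bigr => c _.
  by rewrite ej (eB c a) ?AB // mulrDr !mulrA.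
have [v vE] := subP_solve (fun a => phi w L' a j) (phi_subP_neq0 dE pLE' A).
rewrite (lambda_cond_normal iA (phi_subP_neq0 dE pLE' A) vE).
(* Restoring the arrow adds [L i j] to the coefficient of [i] and changes no other. *)
rewrite (lambda_cond_normal (v := fun b => v b + (b == i)%:R * L i j) iA
  (phi_subP_neq0 dE pL A)); first by rewrite eqxx mul1r.
move=> a aA; rewrite Sj // vE //; under [RHS]eq_bigr => b _ do rewrite mulrDr.
rewrite big_split /=; congr (_ + _).
  by apply: eq_bigr => b bA; rewrite SA.
rewrite (bigD1 i) //= eqxx mul1r big1 ?addr0 // => b /andP[_ /negbTE->].
by rewrite mul0r mulr0.
Qed.

End ConditionalParameters.

Theorem theorem3p3 (R : realType) (n : nat) (E : rel 'I_n) (HE : dag E) :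
  (forall (i : 'I_n) (A : {set 'I_n}), i \notin A ->
     ((forall (w : 'I_n -> R) (L : 'M[R]_n), param E w L ->
         omega_cond (phi w L) i A = w i)
      <-> (pa E i \subset A /\ A \subset ~: dbar E i)))
  /\
  (forall (i j : 'I_n) (A : {set 'I_n}), i != j -> ~~ E i j -> j \notin A ->
     ((forall S : 'M[R]_n, inM E S -> lambda_cond S i j A = 0)
      <-> dsep E (A :\ i) [set i] [set j]))
  /\
  (forall (i j : 'I_n) (A : {set 'I_n}), E i j -> j \notin A ->
     ((forall (w : 'I_n -> R) (L : 'M[R]_n), param E w L ->
         lambda_cond (phi w L) i j A = L i j)
      <-> [/\ i \in A, A \subset ~: dbar E j &
             dsep (Gdel E i j) (A :\ i) [set i] [set j]])).
Proof.
split=> [i A iA|].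
  split=> [H|[paA Ade] w L]; last exact: omega_cond_parents.
  by split; [apply: omega_cond_pa H | apply: omega_cond_nondesc H].
split=> [i j A ij _ jA|i j A Eij jA]; first exact: lambda_cond_dsep.
have ij : i != j by apply: contraTneq Eij => ->; apply/negP => /HE; rewrite connect0.
have dG : dag (Gdel E i j) := dag_sub (@Gdel_sub _ E i j) HE.
split=> [H|[iA Ade sep] w L pL].
  have iA := lambda_cond_mem HE Eij jA H.
  split=> //; first exact: lambda_cond_nondesc H.
  (* Parameters of [Gdel E i j] are parameters of [E] with [L i j = 0], so the hypothesis makes
     [lambda_cond] vanish on the smaller model. *)
  apply/(lambda_cond_dsep R dG ij jA) => _ [w [L [pL ->]]].
  have -> : lambda_cond (phi w L) i j A = L i j.
    apply: H; split=> [|a b nE]; first exact: pL.1.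
    by apply: pL.2; apply: contra nE => /Gdel_sub.
  by apply: pL.2; rewrite Gdel_irr.
have [L' pL' ->] := lambda_cond_Gdel HE Eij iA Ade pL.
have /(lambda_cond_dsep R dG ij jA) -> := sep; first by rewrite add0r.
by exists w, L'.
Qed.
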